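(* Every hyperbolic circle (closed disk) and every hyperbolic Reuleaux polygon, of arbitrary size, is a convex body of constant width; i.e. for each such body $K$ there is $\lambda>0$ with $\mathrm{width}_K(X)=\lambda$ for every ideal point $X\in\mathcal I$.
   Context: The hyperbolic plane has curvature $-1$; $\mathcal I$ denotes the set of its ideal points. For distinct $X,Y\in\mathcal I$, $YX$ denotes the hyperbolic line with ideal endpoints $Y$ and $X$. Let $K$ be a compact convex body (compact convex set with nonempty interior). If $YX$ meets $K$, there are two hypercycles (distance curves) with leading line $YX$, one on each side of it (possibly degenerating to $YX$ itself), which touch $K$ and such that the strip between them contains $K$. Let $d_K^+(YX)$ and $d_K^-(YX)$ be the distances of these two hypercycles from $YX$; that is, $d_K^{\pm}(YX)$ is the maximal distance from $YX$ of a point of $K$ in the respective closed half-plane bounded by $YX$. Put $d_K(YX)=d_K^+(YX)+d_K^-(YX)$. The width of $K$ in the direction $X\in\mathcal I$ is $$\mathrm{width}_K(X)=\sup\{d_K(YX): Y\in\mathcal I\setminus\{X\},\ YX\cap K\neq\emptyset\}.$$ A hyperbolic Reuleaux polygon is a compact convex body of some diameter $d>0$ whose boundary is the union of an odd number $n\ge 3$ of circular arcs of radius $d$, consecutive arcs meeting at the vertices of the polygon, such that the center of each arc is a vertex (the vertex opposite to that arc). *)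

(* Defs.v *)
From mathcomp Require Import all_boot all_order all_algebra.
From mathcomp Require Import all_classical all_reals all_analysis.
Set Implicit Arguments.
Unset Strict Implicit.
Unset Printing Implicit Defensive.
Import Order.TTheory GRing.Theory Num.Theory.
Import numFieldNormedType.Exports.
Local Open Scope classical_set_scope.
Local Open Scope ring_scope.

(* The hyperbolic plane of curvature -1 is the upper sheet z > 0 of the
   hyperboloid x^2 + y^2 - z^2 = -1. The projection (x, y, z) |-> (x, y) is a
   homeomorphism of this sheet onto R^2, and a point is recorded by its image:
   p : R * R stands for [lift p]. The topology of the plane is thus the
   product topology of R * R. *)
Definition lift (R : realType) (p : R * R) : R * R * R :=
  (p.1, p.2, Num.sqrt (1 + p.1 ^+ 2 + p.2 ^+ 2)).

(* Ideal points are the isotropic lines, represented by the points of the unit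
   circle: X stands for the line spanned by [ilift X]. *)
Definition ideal (R : realType) : set (R * R) :=
  [set X | X.1 ^+ 2 + X.2 ^+ 2 = 1].

Definition ilift (R : realType) (X : R * R) : R * R * R := (X.1, X.2, 1).

Definition mink (R : realType) (u v : R * R * R) : R :=
  u.1.1 * v.1.1 + u.1.2 * v.1.2 - u.2 * v.2.

Definition det3 (R : realType) (u v w : R * R * R) : R :=
  u.1.1 * (v.1.2 * w.2 - v.2 * w.1.2)
  - u.1.2 * (v.1.1 * w.2 - v.2 * w.1.1)
  + u.2 * (v.1.1 * w.1.2 - v.1.2 * w.1.1).

Definition arcosh (R : realType) (x : R) : R :=
  ln (x + Num.sqrt (x ^+ 2 - 1)).

Definition dist (R : realType) (p q : R * R) : R :=
  arcosh (- mink (lift p) (lift q)).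

(* Lines are the sections of the sheet by planes through the origin; u and v
   span the plane, and may represent ordinary or ideal points. *)
Definition line (R : realType) (u v : R * R * R) : set (R * R) :=
  [set p | det3 u v (lift p) = 0].

(* One closed side of [line u v]; the other one is [half_plane v u]. *)
Definition half_plane (R : realType) (u v : R * R * R) : set (R * R) :=
  [set p | 0 <= det3 u v (lift p)].

(* Geodesic segments are the sections of the sheet by plane sectors. *)
Definition segment (R : realType) (p q : R * R) : set (R * R) :=
  [set x | exists a b : R, [/\ 0 <= a, 0 <= b
    & lift x = a *: lift p + b *: lift q]].

Definition convex (R : realType) (K : set (R * R)) : Prop :=
  forall p q, K p -> K q -> segment p q `<=` K.

Definition convex_body (R : realType) (K : set (R * R)) : Prop :=
  [/\ compact K, convex K & K° !=set0].

Definition diameter (R : realType) (K : set (R * R)) : R :=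
  sup [set dist pq.1 pq.2 | pq in K `*` K].

Definition dist_to (R : realType) (p : R * R) (L : set (R * R)) : R :=
  inf [set dist p q | q in L].

Definition ideal_line (R : realType) (Y X : R * R) : set (R * R) :=
  line (ilift Y) (ilift X).

(* [d_plus] and [d_minus] are the distances from YX of the two touching
   hypercycles. *)
Definition d_plus (R : realType) (K : set (R * R)) (Y X : R * R) : R :=
  sup [set dist_to p (ideal_line Y X)
      | p in K `&` half_plane (ilift Y) (ilift X)].

Definition d_minus (R : realType) (K : set (R * R)) (Y X : R * R) : R :=
  sup [set dist_to p (ideal_line Y X)
      | p in K `&` half_plane (ilift X) (ilift Y)].

Definition d_strip (R : realType) (K : set (R * R)) (Y X : R * R) : R :=
  d_plus K Y X + d_minus K Y X.

Definition width (R : realType) (K : set (R * R)) (X : R * R) : R :=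
  sup [set d_strip K Y X | Y in
    [set Y | [/\ ideal Y, Y <> X & ideal_line Y X `&` K !=set0]]].

Definition constant_width (R : realType) (K : set (R * R)) : Prop :=
  exists2 lambda : R, 0 < lambda
    & forall X, ideal X -> width K X = lambda.

Definition circle (R : realType) (c : R * R) (r : R) : set (R * R) :=
  [set x | dist c x = r].

Definition disk (R : realType) (c : R * R) (r : R) : set (R * R) :=
  [set x | dist c x <= r].

(* Two distinct points p, q of a circle cut it into two arcs, which lie on the
   two sides of the line pq. *)
Definition is_arc (R : realType) (A : set (R * R)) (c : R * R) (r : R)
    (p q : R * R) : Prop :=
  [/\ p <> q, circle c r p, circle c r q
    & A = circle c r `&` half_plane (lift p) (lift q) \/
      A = circle c r `&` half_plane (lift q) (lift p)].

(* In an n-gon with n odd, whose side i joins vertex i to vertex i + 1 (mod n),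
   the vertex opposite to side i has index i + (n + 1) / 2 (mod n). *)
Definition opposite (n : nat) (i : 'I_n) : 'I_n := iter (uphalf n) (@ordS n) i.

Definition reuleaux_polygon (R : realType) (K : set (R * R)) : Prop :=
  convex_body K /\
  exists (d : R) (n : nat) (v : 'I_n -> R * R) (A : 'I_n -> set (R * R)),
    [/\ 0 < d, diameter K = d, odd n, (3 <= n)%N & injective v] /\
    (forall i, is_arc (A i) (v (opposite i)) d (v i) (v (ordS i))) /\
    closure K `\` K° = \bigcup_i A i.

(* Main.v *)
Require Import Defs.
From mathcomp Require Import all_boot all_order all_algebra.
From mathcomp Require Import all_classical all_reals all_analysis.
From mathcomp Require Import ring lra.
Import Defs.
Set Implicit Arguments.
Unset Strict Implicit.
Unset Printing Implicit Defensive.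
Import Order.TTheory GRing.Theory Num.Theory.
Import numFieldNormedType.Exports.
Local Open Scope classical_set_scope.
Local Open Scope ring_scope.

(* If points p and q of K at distance d = diam K are equidistant from X, then
   the perpendicular bisector YX of pq satisfies d_K(YX) >= d by the triangle
   inequality, and no strip is wider than the diameter; so it suffices to find
   such a pair for every X. In a disk take the diameter perpendicular to the
   line from the center to X. In a Reuleaux polygon suppose that on no arc
   there is a point equidistant with its center from X; by continuity both ends
   of each arc are then on the same side of the horocycle through its center,
   so along the closed chain of the n main diagonals the Busemann function of X
   increases and decreases alternately, which is impossible since n is odd.

   The metric facts all come from the Gram identity for three vectors of
   Minkowski space, and the Busemann function of X is represented by
   [- mink _ (ilift X)], of which it is the logarithm. *)

(** * The function [arcosh]: monotonicity, addition formula, surjectivity *)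

Section Arcosh.
Variable R : realType.
Implicit Types x y : R.

Lemma le_arcosh x y : 1 <= x -> 1 <= y -> (arcosh x <= arcosh y) = (x <= y).
Proof.
have mono (a b : R) : 1 <= a -> a < b -> arcosh a < arcosh b.
  move=> a1 ab; rewrite /arcosh ltr_ln ?posrE.
  - apply: ltr_leD => //; apply: ler_wsqrtr; nra.
  - by have := sqrtr_ge0 (a ^+ 2 - 1); lra.
  - by have := sqrtr_ge0 (b ^+ 2 - 1); lra.
move=> x1 y1; case: (ltrgtP x y) => [xy|yx|->]; last by rewrite lexx.
- exact/ltW/mono.
- by apply/negbTE; rewrite -ltNge; exact: mono.
Qed.

Lemma arcosh_inj x y : 1 <= x -> 1 <= y -> arcosh x = arcosh y -> x = y.
Proof.
move=> x1 y1 e; apply/le_anti.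
by rewrite -(le_arcosh x1 y1) -(le_arcosh y1 x1) e lexx.
Qed.

Lemma arcosh1 : arcosh 1 = 0 :> R.
Proof. by rewrite /arcosh expr1n subrr sqrtr0 addr0 ln1. Qed.

Lemma arcosh_ge0 x : 1 <= x -> 0 <= arcosh x.
Proof. by move=> x1; rewrite -arcosh1 le_arcosh. Qed.

Lemma arcosh_add_ge1 x y : 1 <= x -> 1 <= y ->
  1 <= x * y + Num.sqrt (x ^+ 2 - 1) * Num.sqrt (y ^+ 2 - 1).
Proof.
move=> x1 y1; have := mulr_ge0 (sqrtr_ge0 (x ^+ 2 - 1)) (sqrtr_ge0 (y ^+ 2 - 1)).
by nra.
Qed.

(** This is cosh (a + b) = cosh a cosh b + sinh a sinh b, the square roots being the hyperbolic
    sines. *)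
Lemma arcoshD x y : 1 <= x -> 1 <= y ->
  arcosh (x * y + Num.sqrt (x ^+ 2 - 1) * Num.sqrt (y ^+ 2 - 1)) =
  arcosh x + arcosh y.
Proof.
move=> x1 y1; rewrite /arcosh.
have sx0 := sqrtr_ge0 (x ^+ 2 - 1); have sy0 := sqrtr_ge0 (y ^+ 2 - 1).
have sxE : Num.sqrt (x ^+ 2 - 1) ^+ 2 = x ^+ 2 - 1 by rewrite sqr_sqrtr //; nra.
have syE : Num.sqrt (y ^+ 2 - 1) ^+ 2 = y ^+ 2 - 1 by rewrite sqr_sqrtr //; nra.
move: (Num.sqrt (x ^+ 2 - 1)) (Num.sqrt (y ^+ 2 - 1)) sx0 sy0 sxE syE.
move=> s t s0 t0 sE tE.
(* The right-hand base is sinh (a + b); adding it to [x * y + s * t] gives [(x + s) * (y + t)],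
   which the logarithm splits. *)
have -> : (x * y + s * t) ^+ 2 - 1 = (x * t + y * s) ^+ 2.
  by apply/eqP; rewrite -subr_eq0; apply/eqP; ring: sE tE.
rewrite sqrtr_sqr ger0_norm; last by nra.
rewrite -lnM ?posrE; [congr ln; ring|lra|lra].
Qed.

Lemma arcosh_surj r : 0 < r -> exists2 x : R, 1 < x & arcosh x = r.
Proof.
move=> r0; pose e := expR r.
have e1 : 1 < e by rewrite expR_gt1.
exists ((e + e^-1) / 2).
  have ee : e * e^-1 = 1 by rewrite mulfV //; lra.
  have := sqr_ge0 (e - 1); nra.
rewrite /arcosh.
have -> : ((e + e^-1) / 2) ^+ 2 - 1 = ((e - e^-1) / 2) ^+ 2 by field; lra.
rewrite sqrtr_sqr ger0_norm.
  rewrite (_ : _ + _ = e) ?expRK //; by field; lra.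
have : e^-1 <= 1 by rewrite invf_le1; lra.
lra.
Qed.

End Arcosh.

(** * Algebra of the Minkowski form and the Gram identity *)

Section Minkowski.
Variable R : realType.
Implicit Types u v w a b c : R * R * R.

(** The Lorentzian cross product: the last Euclidean coordinate changes sign, so that [mink] with it
    gives the determinant. *)
Definition cross u v : R * R * R :=
  (u.1.2 * v.2 - u.2 * v.1.2, u.2 * v.1.1 - u.1.1 * v.2,
   u.1.2 * v.1.1 - u.1.1 * v.1.2).

Lemma minkC u v : mink u v = mink v u.
Proof. by rewrite /mink; ring. Qed.

Lemma minkDl u v w : mink (u + v) w = mink u w + mink v w.
Proof. by case: u v w => [[? ?] ?] [[? ?] ?] [[? ?] ?]; rewrite /mink /=; ring. Qed.

Lemma minkZl k u w : mink (k *: u) w = k * mink u w.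
Proof.
by case: u w => [[? ?] ?] [[? ?] ?]; rewrite /mink /= /GRing.scale /=; ring.
Qed.

Lemma minkDr u v w : mink w (u + v) = mink w u + mink w v.
Proof. by rewrite !(minkC w) minkDl. Qed.

Lemma minkZr k u w : mink w (k *: u) = k * mink w u.
Proof. by rewrite !(minkC w) minkZl. Qed.

Definition minkE := (minkDl, minkDr, minkZl, minkZr).

Lemma mink_cross u v w : mink (cross u v) w = det3 u v w.
Proof. by rewrite /mink /det3 /=; ring. Qed.

Lemma mink_cross_cross u v :
  mink (cross u v) (cross u v) = mink u v ^+ 2 - mink u u * mink v v.
Proof. by rewrite /mink /cross /=; ring. Qed.

Lemma det3Dr u v a b : det3 u v (a + b) = det3 u v a + det3 u v b.
Proof. by rewrite -!mink_cross minkDr. Qed.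

Lemma det3Zr u v k a : det3 u v (k *: a) = k * det3 u v a.
Proof. by rewrite -!mink_cross minkZr. Qed.

Lemma det3_rot u v w : det3 v w u = det3 u v w.
Proof. by rewrite /det3; ring. Qed.

Lemma det3Dl a b u v : det3 (a + b) u v = det3 a u v + det3 b u v.
Proof. by rewrite -!(det3_rot _ u v) det3Dr. Qed.

Lemma det3Zl k a u v : det3 (k *: a) u v = k * det3 a u v.
Proof. by rewrite -!(det3_rot _ u v) det3Zr. Qed.

Lemma det3_swap u v w : det3 v u w = - det3 u v w.
Proof. by rewrite /det3; ring. Qed.

Lemma det3uuv u v : det3 u u v = 0.
Proof. by rewrite /det3; ring. Qed.

Lemma det3uvu u v : det3 u v u = 0.
Proof. by rewrite /det3; ring. Qed.

Lemma det3uvv u v : det3 u v v = 0.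
Proof. by rewrite /det3; ring. Qed.

(** Determinants are multiplicative; the sign is the determinant of the form diag(1, 1, -1). *)
Lemma det3_gram u v w a b c :
  det3 u v w * det3 a b c =
  - (mink u a * (mink v b * mink w c - mink v c * mink w b)
     - mink u b * (mink v a * mink w c - mink v c * mink w a)
     + mink u c * (mink v a * mink w b - mink v b * mink w a)).
Proof. by rewrite /det3 /mink; ring. Qed.

End Minkowski.

(** * Causal vectors and points of the sheet *)

Section Sheet.
Variable R : realType.
Implicit Types p q c x z X Y : R * R.

Lemma mink_lift p : mink (lift p) (lift p) = -1.
Proof.
rewrite /mink /lift /= -expr2 -expr2 -expr2 sqr_sqrtr; first by ring.
by have := sqr_ge0 p.1; have := sqr_ge0 p.2; lra.
Qed.

Lemma lift3_gt0 p : 0 < (lift p).2.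
Proof.
by rewrite sqrtr_gt0; have := sqr_ge0 p.1; have := sqr_ge0 p.2; lra.
Qed.

Lemma lift_onto (u : R * R * R) : mink u u = -1 -> 0 < u.2 -> lift u.1 = u.
Proof.
case: u => [[a b] c] /=; rewrite /mink /lift /= => e c0.
rewrite (_ : 1 + _ + _ = c ^+ 2); last by lra.
by rewrite sqrtr_sqr gtr0_norm.
Qed.

(** Reversed Cauchy-Schwarz inequality, obtained from the Euclidean one for (1, a, b) and (1, c,
    d). *)
Lemma mink_lift_le p q : mink (lift p) (lift q) <= -1.
Proof.
have p0 := lift3_gt0 p; have q0 := lift3_gt0 q.
have := mink_lift p; have := mink_lift q.
case: (lift p) p0 => [[a b] s]; case: (lift q) q0 => [[c d] t].
rewrite /mink /= => t0 s0 e f.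
have st0 : 0 < s * t by rewrite mulr_gt0.
rewrite leNgt; apply/negP => h.
have h1 : 0 <= a * c + b * d + 1 + s * t by lra.
have : (s * t) ^+ 2 < (a * c + b * d + 1) ^+ 2.
  by rewrite ltr_sqr ?nnegrE; lra.
have := sqr_ge0 (a - c); have := sqr_ge0 (b - d); have := sqr_ge0 (a * d - b * c).
have -> : (s * t) ^+ 2 = (1 + a * a + b * b) * (1 + c * c + d * d).
  rewrite exprMn !expr2; congr (_ * _); lra.
by nra.
Qed.

Lemma mink_lift_ideal p X : ideal X -> mink (lift p) (ilift X) < 0.
Proof.
rewrite /ideal /= => iX.
have p0 := lift3_gt0 p; have := mink_lift p.
case: (lift p) p0 => [[a b] s]; case: X iX => [c d] /=.
rewrite /mink /= => iX s0 e.
rewrite mulr1 subr_lt0 ltNge; apply/negP => h.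
have : s ^+ 2 <= (a * c + b * d) ^+ 2 by rewrite ler_sqr ?nnegrE; lra.
have := sqr_ge0 (a * d - b * c).
have : (a * d - b * c) ^+ 2 + (a * c + b * d) ^+ 2 = a ^+ 2 + b ^+ 2.
  by rewrite -[RHS]mulr1 -iX; ring.
by nra.
Qed.

Lemma mink_ilift X : ideal X -> mink (ilift X) (ilift X) = 0.
Proof. by rewrite /ideal /mink /= => iX; lra. Qed.

(** If the height were not positive, the spatial parts would violate the Euclidean Cauchy-Schwarz
    inequality. *)
Lemma future_gt0 c (u : R * R * R) :
  mink u u <= 0 -> mink u (lift c) < 0 -> 0 < u.2.
Proof.
have c0 := lift3_gt0 c; have := mink_lift c.
case: (lift c) c0 => [[a b] s]; case: u => [[x y] t].
rewrite /mink /= => s0 e h1 h2; rewrite ltNge; apply/negP => t0.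
have st0 : s * t <= 0 by rewrite mulr_ge0_le0 // ltW.
have : (s * t) ^+ 2 < (x * a + y * b) ^+ 2.
  by rewrite -[X in X < _]sqrrN -[X in _ < X]sqrrN ltr_sqr ?nnegrE; lra.
have : (x * a + y * b) ^+ 2 <= (x ^+ 2 + y ^+ 2) * (a ^+ 2 + b ^+ 2).
  by rewrite -subr_ge0 (_ : _ - _ = (a * y - b * x) ^+ 2) ?sqr_ge0 //; ring.
have : (x ^+ 2 + y ^+ 2) * (a ^+ 2 + b ^+ 2) <= t ^+ 2 * s ^+ 2.
  by apply: ler_pM; rewrite ?addr_ge0 ?sqr_ge0 //; lra.
by rewrite exprMn; lra.
Qed.

Lemma lift_of_future c (u : R * R * R) :
  mink u u = -1 -> mink u (lift c) < 0 -> lift u.1 = u.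
Proof.
move=> uu uc; apply: lift_onto => //.
by apply: (@future_gt0 c) => //; rewrite uu; lra.
Qed.

(** Since [mink (lift p) (lift q)] is at most -1, the combination is timelike, and [k] normalizes it
    onto the sheet. *)
Lemma segment_span p q a b : 0 <= a -> 0 <= b -> 0 < a + b ->
  exists k x, 0 < k /\ lift x = k *: (a *: lift p + b *: lift q).
Proof.
move=> a0 b0 ab0.
pose w := mink (lift p) (lift q); have w1 : w <= -1 := mink_lift_le p q.
pose m := a *: lift p + b *: lift q.
have mm : mink m m = - (a ^+ 2 + b ^+ 2 - 2 * a * b * w).
  by rewrite /m !minkE !mink_lift (minkC (lift q)) -/w; ring.
have N0 : 0 < a ^+ 2 + b ^+ 2 - 2 * a * b * w.
  have : 0 <= a * b * (-1 - w) by rewrite !mulr_ge0 //; lra.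
  have : 0 < (a + b) ^+ 2 by rewrite exprn_gt0.
  by lra.
pose k := (Num.sqrt (a ^+ 2 + b ^+ 2 - 2 * a * b * w))^-1.
have k0 : 0 < k by rewrite invr_gt0 sqrtr_gt0.
have kN : k ^+ 2 * (a ^+ 2 + b ^+ 2 - 2 * a * b * w) = 1.
  by rewrite exprVn sqr_sqrtr ?(ltW N0) // mulVf // gt_eqF.
exists k, (k *: m).1; split => //.
apply: (@lift_of_future p); first by rewrite minkZl minkZr mm; lra.
rewrite /m !minkE mink_lift (minkC (lift q)) -/w.
rewrite pmulr_rlt0 //.
have : b * w <= b * -1 by rewrite ler_wpM2l.
by lra.
Qed.

Lemma det3_lift_sqr p q z :
  det3 (lift p) (lift q) (lift z) ^+ 2 =
  1 - mink (lift p) (lift q) ^+ 2 - mink (lift p) (lift z) ^+ 2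
    - mink (lift q) (lift z) ^+ 2
    - 2 * mink (lift p) (lift q) * mink (lift p) (lift z) * mink (lift q) (lift z).
Proof.
rewrite expr2 det3_gram !mink_lift (minkC (lift z)) (minkC (lift z)).
by rewrite (minkC (lift q) (lift p)); ring.
Qed.

End Sheet.

(** * Triangle inequality and geodesic segments *)

Section Distance.
Variable R : realType.
Implicit Types p q c x z X Y : R * R.

Lemma distC p q : dist p q = dist q p.
Proof. by rewrite /dist minkC. Qed.

Lemma mink_lift_ge1 p q : 1 <= - mink (lift p) (lift q).
Proof. by have := mink_lift_le p q; lra. Qed.

Lemma dist_ge0 p q : 0 <= dist p q.
Proof. exact/arcosh_ge0/mink_lift_ge1. Qed.

(** For the hyperbolic cosines w, x, y of the sides, nonnegativity of the squared determinant reads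
    (w - xy)^2 <= (x^2 - 1)(y^2 - 1); then [arcoshD] applies. *)
Lemma dist_triangle z p q : dist p q <= dist p z + dist z q.
Proof.
rewrite /dist (minkC (lift z)) -arcoshD ?mink_lift_ge1 //.
rewrite le_arcosh ?arcosh_add_ge1 ?mink_lift_ge1 //.
have w1 := mink_lift_ge1 p q; have x1 := mink_lift_ge1 p z.
have y1 := mink_lift_ge1 q z.
have := sqr_ge0 (det3 (lift p) (lift q) (lift z)); rewrite det3_lift_sqr.
move: (mink _ _) (mink _ _) (mink _ _) w1 x1 y1 => w x y w1 x1 y1 D.
rewrite -sqrtrM; last by nra.
rewrite -lerBlDl; apply: le_trans (ler_norm _) _; rewrite -sqrtr_sqr.
by apply: ler_wsqrtr; nra.
Qed.

Lemma dist_segment p q z : segment p q z -> dist p z + dist z q = dist p q.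
Proof.
move=> [a [b [a0 b0 zE]]]; rewrite /dist (minkC (lift z) (lift q)).
rewrite -arcoshD ?mink_lift_ge1 //; congr arcosh.
have w1 := mink_lift_ge1 p q.
have : mink (lift z) (lift z) = -1 := mink_lift z.
rewrite {1 2}zE zE !minkE !mink_lift (minkC (lift q) (lift p)).
move: (mink _ _) w1 => w w1 e.
have bb : b ^+ 2 = 1 - a ^+ 2 + 2 * a * b * w by lra.
have sE t : 0 <= t -> Num.sqrt (t ^+ 2 * (w ^+ 2 - 1)) = t * Num.sqrt (w ^+ 2 - 1).
  by move=> t0; rewrite sqrtrM ?sqr_ge0 // sqrtr_sqr ger0_norm.
(* The hyperbolic sines of the two partial distances are [b] and [a] times that of [dist p q]. *)
have -> : (- (a * -1 + b * w)) ^+ 2 - 1 = b ^+ 2 * (w ^+ 2 - 1) by lra.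
have -> : (- (a * w + b * -1)) ^+ 2 - 1 = a ^+ 2 * (w ^+ 2 - 1) by lra.
have ww : Num.sqrt (w ^+ 2 - 1) ^+ 2 = w ^+ 2 - 1 by rewrite sqr_sqrtr //; nra.
rewrite !sE //.
by ring: bb ww.
Qed.

Lemma segment_line (u v : R * R * R) p q :
  0 <= det3 u v (lift p) -> det3 u v (lift q) <= 0 ->
  exists2 z, segment p q z & line u v z.
Proof.
move=> p0 q0.
have [pp|pp] := eqVneq (det3 u v (lift p)) 0.
  exists p => //; exists 1, 0; split; rewrite ?ler01 //.
  by rewrite scale1r scale0r addr0.
have pp0 : 0 < det3 u v (lift p) by rewrite lt_neqAle eq_sym pp.
(* With these weights the values of the linear form [det3 u v] at the two ends cancel. *)
have [||| k [z [k0 zE]]] := @segment_span R p q (- det3 u v (lift q)) (det3 u v (lift p)); try lra.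
exists z; last by rewrite /line /= zE !(det3Zr, det3Dr); ring.
exists (k * - det3 u v (lift q)), (k * det3 u v (lift p)).
split; [by nra|by nra|by rewrite zE scalerDr !scalerA].
Qed.

Lemma eq_dist p q z : mink (lift z) (lift p) = mink (lift z) (lift q) ->
  dist p z = dist q z.
Proof. by rewrite /dist !(minkC (lift z)) => ->. Qed.

End Distance.

(** * Perpendicular bisectors, strips and the width *)

Section Width.
Variable R : realType.
Implicit Types (p q c x z X Y : R * R) (L K : set (R * R)).

Lemma dist_to_le p L z : L z -> dist_to p L <= dist p z.
Proof.
move=> Lz; apply: ge_inf; last by exists z.
by exists 0 => _ [y _ <-]; exact: dist_ge0.
Qed.

Lemma ilift_direction (u : R * R * R) : u.2 != 0 ->
  ilift (u.1.1 / u.2, u.1.2 / u.2) = u.2^-1 *: u.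
Proof.
case: u => [[x y] t] /= t0; rewrite /ilift.
by rewrite -(mulVf t0) !(mulrC _ t^-1).
Qed.

(* [Y] is the second end of the perpendicular bisector of [pq]: the mirror image
   of [X] in the line through the origin and [lift p + lift q]. *)
Lemma bisector_ideal p q X : ideal X -> mink (lift p) (lift q) < -1 ->
  mink (lift p) (ilift X) = mink (lift q) (ilift X) ->
  exists Y k, [/\ ideal Y, Y <> X, k != 0 & forall u : R * R * R,
    det3 (ilift Y) (ilift X) u = k * (mink (lift p) u - mink (lift q) u)].
Proof.
move=> iX w1 e; have b0 := mink_lift_ideal p iX.
have XX := mink_ilift iX.
pose m := lift p + lift q; pose n := lift p + (-1) *: lift q.
pose w := mink (lift p) (lift q); pose b := mink (lift p) (ilift X).
have mX : mink m (ilift X) = 2 * b by rewrite minkDl -e -/b; ring.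
have mm : mink m m = 2 * w - 2.
  by rewrite !minkE !mink_lift (minkC (lift q)) -/w; ring.
(* As [n] is orthogonal to [m] and [ilift X], the Gram identity makes the form [det3 m (ilift X)]
   proportional to the product with [n]. *)
have D u : det3 m (ilift X) u * det3 m (ilift X) n = mink u n * (2 * b) ^+ 2.
  have mn : mink m n = 0.
    by rewrite !minkE !mink_lift (minkC (lift q)); ring.
  have Xn : mink (ilift X) n = 0.
    by rewrite minkC !minkE -e; ring.
  by rewrite det3_gram mn Xn (minkC _ m) mX XX; ring.
have nn : mink n n = -2 - 2 * w.
  by rewrite !minkE !mink_lift (minkC (lift q)) -/w; ring.
pose D0 := det3 m (ilift X) n.
have D00 : D0 != 0.
  apply/eqP => D0E; have := D n; rewrite -/D0 D0E mulr0 nn => /esym/eqP.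
  rewrite mulf_eq0 sqrf_eq0 => /orP[]/eqP; rewrite /w /b; lra.
(* The nonzero solution of the equation that makes [s *: m - ilift X] isotropic. *)
pose s := 2 * b / (w - 1).
have sw : s * (w - 1) = 2 * b by rewrite /s mulfVK // /w; lra.
have s0 : 0 < s by rewrite /s nmulr_lgt0 ?invr_lt0 /w /b; lra.
pose V := s *: m + (-1) *: ilift X.
have VV : mink V V = 0.
  rewrite minkDl !minkDr !minkZl !minkZr mm (minkC _ m) mX XX.
  by rewrite -sw; ring.
have Vp : mink V (lift p) < 0.
  rewrite minkDl !minkZl minkDl mink_lift (minkC (lift q)) (minkC (ilift X)) -/b -/w.
  by rewrite -/w; rewrite (_ : _ + _ = b); [exact: b0|lra].
have V0 : 0 < V.2 by apply: (@future_gt0 _ p); rewrite ?VV.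
pose Y := (V.1.1 / V.2, V.1.2 / V.2).
have YE : ilift Y = V.2^-1 *: V by exact/ilift_direction/lt0r_neq0.
have det u : det3 (ilift Y) (ilift X) u =
    V.2^-1 * s * (2 * b) ^+ 2 / D0 * (mink (lift p) u - mink (lift q) u).
  rewrite YE det3Zl det3Dl !det3Zl det3uuv mulr0 addr0.
  rewrite -[det3 m _ u](mulfK D00) D !minkE !(minkC u).
  by rewrite mulN1r; ring.
have k0 : V.2^-1 * s * (2 * b) ^+ 2 / D0 != 0.
  have b20 : (2 * b) ^+ 2 != 0.
    by rewrite expf_neq0 // mulf_neq0 ?pnatr_eq0 // ltr0_neq0.
  apply: mulf_neq0; last by rewrite invr_eq0.
  by apply: mulf_neq0 => //; apply: lt0r_neq0; rewrite mulr_gt0 ?invr_gt0.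
exists Y, (V.2^-1 * s * (2 * b) ^+ 2 / D0); split => //.
  rewrite /ideal /=; have : mink (ilift Y) (ilift Y) = 0.
    by rewrite YE minkZl minkZr VV !mulr0.
  by rewrite /mink /=; lra.
move=> YX; have := det (lift p).
rewrite YX /det3 mink_lift (minkC (lift q)) => /esym/eqP.
rewrite (_ : _ - _ + _ = 0); last by ring.
by rewrite mulf_eq0 (negbTE k0) /= => /eqP; lra.
Qed.

Section Bounds.
Variables (K : set (R * R)) (d : R) (Y X : R * R).
Hypothesis Kd : forall p q, K p -> K q -> dist p q <= d.
Hypothesis YXK : ideal_line Y X `&` K !=set0.

Lemma dist_to_line_le p : K p -> dist_to p (ideal_line Y X) <= d.
Proof.
by case: YXK => z [Lz Kz] Kp; apply: le_trans (dist_to_le _ Lz) (Kd Kp Kz).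
Qed.

Lemma dist_to_le_d_plus p : K p -> half_plane (ilift Y) (ilift X) p ->
  dist_to p (ideal_line Y X) <= d_plus K Y X.
Proof.
move=> Kp hp; apply: ub_le_sup; last by exists p.
by exists d => _ [x [Kx _] <-]; exact: dist_to_line_le.
Qed.

Lemma dist_to_le_d_minus p : K p -> half_plane (ilift X) (ilift Y) p ->
  dist_to p (ideal_line Y X) <= d_minus K Y X.
Proof.
move=> Kp hp; apply: ub_le_sup; last by exists p.
by exists d => _ [x [Kx _] <-]; exact: dist_to_line_le.
Qed.

(** A segment joining points on the two sides crosses the line, and its two pieces are at least as
    long as the distances of its ends from the line. *)
Lemma d_strip_le : d_strip K Y X <= d.
Proof.
case: YXK => z [Lz Kz].
(* A point of [K] on the line lies on both closed sides, so both suprema are taken over nonempty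
   sets. *)
have hz : half_plane (ilift Y) (ilift X) z by rewrite /half_plane /= Lz.
have hz' : half_plane (ilift X) (ilift Y) z.
  by rewrite /half_plane /= det3_swap Lz oppr0.
rewrite /d_strip -lerBrDr; apply: ge_sup => [|_ [p [Kp hp] <-]].
  by exists (dist_to z (ideal_line Y X)), z.
rewrite lerBrDl -lerBrDr; apply: ge_sup => [|_ [q [Kq hq] <-]].
  by exists (dist_to z (ideal_line Y X)), z.
have [|y sy Ly] := segment_line hp (q := q).
  by move: hq; rewrite /half_plane /= det3_swap oppr_ge0.
rewrite lerBrDr; apply: le_trans (Kd Kp Kq).
rewrite -(dist_segment sy) addrC; apply: lerD; first exact: dist_to_le.
by rewrite distC; exact: dist_to_le.
Qed.

End Bounds.

Lemma width_eq_diametral K d X p q :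
  convex K -> 0 < d -> (forall x y, K x -> K y -> dist x y <= d) ->
  ideal X -> K p -> K q -> dist p q = d ->
  mink (lift p) (ilift X) = mink (lift q) (ilift X) -> width K X = d.
Proof.
move=> cK d0 Kd iX Kp Kq pq e.
have w1 : mink (lift p) (lift q) < -1.
  rewrite lt_neqAle mink_lift_le andbT; apply/eqP => w.
  by move: d0; rewrite -pq /dist w opprK arcosh1 ltxx.
have [Y [k [iY YX k0 det]]] := bisector_ideal iX w1 e.
have [||| t [m [t0 mE]]] := @segment_span R p q 1 1; rewrite ?ler01 ?addr_gt0 //.
(* The midpoint of [p] and [q] shows that the bisector meets [K]. *)
have Km : K m.
  by apply: (cK p q) => //; exists t, t; rewrite mE !scale1r scalerDr !ltW.
have Lm : ideal_line Y X m.
  rewrite /ideal_line /line /= det mE !minkE !mink_lift (minkC (lift q)).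
  by ring.
have YXK : ideal_line Y X `&` K !=set0 by exists m.
have far z : ideal_line Y X z -> dist p z = dist q z /\ d / 2 <= dist p z.
  rewrite /ideal_line /line /= det => /eqP.
  rewrite mulf_eq0 (negbTE k0) subr_eq0 /= => /eqP ez.
  have pz : dist p z = dist q z by apply: eq_dist; rewrite !(minkC (lift z)).
  split => //; have := dist_triangle z p q; rewrite pq (distC z) -pz; lra.
have farp : d / 2 <= dist_to p (ideal_line Y X).
  apply: lb_le_inf => [|_ [z Lz <-]]; first by exists (dist p m), m.
  by case: (far z Lz).
have farq : d / 2 <= dist_to q (ideal_line Y X).
  apply: lb_le_inf => [|_ [z Lz <-]]; first by exists (dist q m), m.
  by case: (far z Lz) => <-.
have strip : d <= d_strip K Y X.
  have detp : det3 (ilift Y) (ilift X) (lift p) = k * (-1 - mink (lift p) (lift q)).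
    by rewrite det mink_lift (minkC (lift q)).
  have detq : det3 (ilift Y) (ilift X) (lift q) = - (k * (-1 - mink (lift p) (lift q))).
    by rewrite det mink_lift; ring.
  (* The sign of [k] decides which of [p] and [q] lies on which side of the bisector. *)
  have [kp|kn] : 0 <= k * (-1 - mink (lift p) (lift q)) \/
      0 <= - (k * (-1 - mink (lift p) (lift q))).
    by rewrite oppr_ge0; apply/orP; exact: le_total.
  - have hp : half_plane (ilift Y) (ilift X) p by rewrite /half_plane /= detp.
    have hq : half_plane (ilift X) (ilift Y) q.
      by rewrite /half_plane /= det3_swap detq opprK.
    have := dist_to_le_d_plus Kd YXK Kp hp; have := dist_to_le_d_minus Kd YXK Kq hq.
    by rewrite /d_strip; lra.
  - have hq : half_plane (ilift Y) (ilift X) q by rewrite /half_plane /= detq.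
    have hp : half_plane (ilift X) (ilift Y) p.
      by rewrite /half_plane /= det3_swap detp.
    have := dist_to_le_d_plus Kd YXK Kq hq; have := dist_to_le_d_minus Kd YXK Kp hp.
    by rewrite /d_strip; lra.
have ub : ubound [set d_strip K Z X | Z in
    [set Z | [/\ ideal Z, Z <> X & ideal_line Z X `&` K !=set0]]] d.
  by move=> _ [Z [_ _ ZK] <-]; exact: d_strip_le.
apply/le_anti/andP; split.
  by apply: ge_sup => //; exists (d_strip K Y X), Y.
by apply: le_trans strip _; apply: ub_le_sup; [exists d|exists Y].
Qed.

End Width.

(** * Disks are convex bodies of constant width *)

Section Disk.
Variable R : realType.
Implicit Types (p q c x z X Y : R * R) (r : R).

Lemma le_dist (C : R) c x : 1 <= C ->
  (dist c x <= arcosh C) = (- mink (lift c) (lift x) <= C).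
Proof. by move=> C1; rewrite /dist le_arcosh ?mink_lift_ge1. Qed.

Lemma continuous_mink_lift c : continuous (fun x => - mink (lift c) (lift x)).
Proof.
move=> x; rewrite /mink /lift /=.
apply: cvgN; apply: cvgB; first apply: cvgD.
- by apply: cvgM; [exact: cvg_cst|exact: cvg_fst].
- by apply: cvgM; [exact: cvg_cst|exact: cvg_snd].
- apply: cvgM; first exact: cvg_cst.
  apply: (continuous_cvg _ (@sqrt_continuous R _)).
  apply: cvgD; first (apply: cvgD; first exact: cvg_cst).
  + by rewrite expr2; apply: cvgM; exact: cvg_fst.
  + by rewrite expr2; apply: cvgM; exact: cvg_snd.
Qed.

(** Coefficients of a point of a segment satisfy [a + b <= 1], so the linear form [- mink (lift c)]
    cannot exceed its bound at the ends. *)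
Lemma convex_disk c r : 0 < r -> convex (disk c r).
Proof.
move=> /arcosh_surj[C C1 <-] p q; rewrite /disk /= !le_dist ?(ltW C1) //.
move=> pC qC z [a [b [a0 b0 zE]]].
rewrite /= le_dist ?(ltW C1) // zE !minkE.
have w := mink_lift_le p q.
have := mink_lift z; rewrite {1 2}zE !minkE !mink_lift (minkC (lift q)) => e.
have ab1 : a + b <= 1.
  have : 0 <= a * b * (-1 - mink (lift p) (lift q)).
    by rewrite !mulr_ge0 //; lra.
  move=> abw; have : (a + b) ^+ 2 <= 1 ^+ 2 by lra.
  by rewrite ler_sqr ?nnegrE ?addr_ge0.
have : a * - mink (lift c) (lift p) <= a * C by rewrite ler_wpM2l.
have : b * - mink (lift c) (lift q) <= b * C by rewrite ler_wpM2l.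
have : (a + b) * C <= 1 * C by rewrite ler_wpM2r //; lra.
by lra.
Qed.

(** The disk lies in one about the origin, and the height of a point is the hyperbolic cosine of its
    distance from there and bounds both coordinates. *)
Lemma disk_sub_square c r : 0 < r ->
  exists M : R, disk c r `<=` `[- M, M] `*` `[- M, M].
Proof.
move=> r0; pose o : R * R := (0, 0).
have [|M M1 ME] := @arcosh_surj R (dist o c + r).
  by have := dist_ge0 o c; lra.
exists M => x; rewrite /disk /= => cx.
have : dist o x <= arcosh M.
  by rewrite ME; apply: le_trans (dist_triangle c o x) _; rewrite lerD2l.
rewrite le_dist ?(ltW M1) // {1}/mink /= !mul0r expr0n /= !addr0 sqrtr1 mul1r.
rewrite add0r opprK => sM.
have s0 := sqrtr_ge0 (1 + x.1 ^+ 2 + x.2 ^+ 2).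
have x1 := sqr_ge0 x.1; have x2 := sqr_ge0 x.2.
have sE : Num.sqrt (1 + x.1 ^+ 2 + x.2 ^+ 2) ^+ 2 = 1 + x.1 ^+ 2 + x.2 ^+ 2.
  by rewrite sqr_sqrtr //; lra.
have MM : 1 + x.1 ^+ 2 + x.2 ^+ 2 <= M ^+ 2 by rewrite -sE ler_sqr ?nnegrE; lra.
by rewrite !in_itv /= -!ler_norml -!(@ler_sqr _ `|_|) ?nnegrE ?normr_ge0 //
  ?real_normK ?num_real //; try split; lra.
Qed.

Lemma compact_disk c r : 0 < r -> compact (disk c r).
Proof.
move=> r0; have [M subM] := disk_sub_square c r0.
apply: subclosed_compact subM; last by apply: compact_setX; exact: segment_compact.
have [C C1 CE] := arcosh_surj r0.
have -> : disk c r = (fun x => - mink (lift c) (lift x)) @^-1` [set y | y <= C].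
  by apply/seteqP; split=> x; rewrite /disk /= -CE le_dist // ltW.
by apply: preimage_closed; [move=> x _; exact: continuous_mink_lift|exact: closed_le].
Qed.

Lemma disk_interior c r : 0 < r -> (disk c r)° !=set0.
Proof.
move=> r0; exists c; have [C C1 CE] := arcosh_surj r0.
have oC : open ((fun x => - mink (lift c) (lift x)) @^-1` [set y | y < C]).
  by apply: open_comp; [move=> x _; exact: continuous_mink_lift|exact: open_lt].
apply: (@filterS _ _ _ _ (disk c r) _ (open_nbhs_nbhs (conj oC _))).
  by move=> x /= /ltW; rewrite -le_dist ?(ltW C1) // CE.
by rewrite /= mink_lift opprK.
Qed.

Lemma convex_body_disk c r : 0 < r -> convex_body (disk c r).
Proof.
by move=> r0; split; [exact: compact_disk|exact: convex_disk|exact: disk_interior].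
Qed.

Lemma disk_diametral c r X : 0 < r -> ideal X -> exists p q,
  [/\ disk c r p, disk c r q, dist p q = r + r &
      mink (lift p) (ilift X) = mink (lift q) (ilift X)].
Proof.
move=> /arcosh_surj[C C1 CE] iX.
have b0 := mink_lift_ideal c iX; set b := mink _ _ in b0.
(* The normal of the line from [c] to [X]; moving along it does not change the product with
   [ilift X]. *)
pose e := cross (lift c) (ilift X).
have ec : mink e (lift c) = 0 by rewrite mink_cross det3uvu.
have eX : mink e (ilift X) = 0 by rewrite mink_cross det3uvv.
have ee : mink e e = b ^+ 2 by rewrite mink_cross_cross mink_ilift // mulr0 subr0.
pose S := Num.sqrt (C ^+ 2 - 1).
have SE : S ^+ 2 = C ^+ 2 - 1 by rewrite sqr_sqrtr //; nra.
(* As [e] has length |b|, these are the points at distance [r] from [c] on the geodesic with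
   direction [e]: [C] is cosh r and [S] is sinh r. *)
have pt (s : R) : s ^+ 2 = (S / b) ^+ 2 ->
    lift (C *: lift c + s *: e).1 = C *: lift c + s *: e.
  move=> sE; apply: (@lift_of_future _ c); rewrite !minkE ec mink_lift; last by lra.
  rewrite (minkC (lift c)) ec ee.
  rewrite (_ : _ + _ = - C ^+ 2 + s ^+ 2 * b ^+ 2); last by ring.
  by rewrite sE exprMn exprVn mulfVK ?sqrf_eq0 ?ltr0_neq0 // SE; ring.
have lp := pt (S / b) erefl; have lq := pt (- (S / b)) (sqrrN _).
exists (C *: lift c + (S / b) *: e).1, (C *: lift c + (- (S / b)) *: e).1.
split.
- rewrite /disk /= /dist lp !minkE mink_lift (minkC _ e) ec.
  by rewrite (_ : - _ = C) ?CE //; ring.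
- rewrite /disk /= /dist lq !minkE mink_lift (minkC _ e) ec.
  by rewrite (_ : - _ = C) ?CE //; ring.
- rewrite /dist lp lq !minkE mink_lift (minkC _ e) ec ee -CE -arcoshD ?(ltW C1) //.
  congr arcosh; rewrite -/S -expr2 -expr2 SE.
  have : (S / b) ^+ 2 * b ^+ 2 = S ^+ 2.
    by rewrite exprMn exprVn mulfVK ?sqrf_eq0 ?ltr0_neq0.
  rewrite SE; move: (S / b) => s sE; lra.
- by rewrite lp lq !minkE eX; ring.
Qed.

Lemma constant_width_disk c r : 0 < r -> constant_width (disk c r).
Proof.
move=> r0; exists (r + r) => [|X iX]; first by rewrite addr_gt0.
have [p [q [cp cq pq e]]] := disk_diametral c r0 iX.
apply: (width_eq_diametral _ _ _ iX cp cq pq e); first exact: convex_disk.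
  by rewrite addr_gt0.
move=> x y cx cy; apply: le_trans (dist_triangle c x y) _.
by rewrite distC lerD.
Qed.

End Disk.

(** * Reuleaux polygons: equidistant points on arcs and the parity argument *)

Section Reuleaux.
Variable R : realType.
Implicit Types (p q c x z X Y : R * R) (r : R).

(** The product [g / k] of the roots is nonpositive, so one root has the sign of [t]. *)
Lemma quadratic_root (k h g t : R) : 0 < k -> g <= 0 ->
  exists2 s, k * s ^+ 2 + 2 * h * s + g = 0 & 0 <= s * t.
Proof.
move=> k0 g0; pose D := Num.sqrt (h ^+ 2 - k * g).
have DE : D ^+ 2 = h ^+ 2 - k * g.
  by rewrite sqr_sqrtr // subr_ge0 (le_trans _ (sqr_ge0 _)) // pmulr_rle0.
have hD : `|h| <= D.
  rewrite -sqrtr_sqr ler_wsqrtr // lerDl oppr_ge0 pmulr_rle0 //.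
move: hD; rewrite ler_norml => /andP[Dh hD].
have root (s : R) : s ^+ 2 = D ^+ 2 ->
    k * ((- h + s) / k) ^+ 2 + 2 * h * ((- h + s) / k) + g = 0.
  move=> sE; have kk : k != 0 by rewrite gt_eqF.
  have -> : g = (h ^+ 2 - s ^+ 2) / k by rewrite sE DE; field.
  by field.
have [t0|t0] := leP 0 t.
  exists ((- h + D) / k); first exact: root.
  by rewrite mulr_ge0 // divr_ge0 ?(ltW k0) //; lra.
exists ((- h + - D) / k); first by apply: root; rewrite sqrrN.
apply: mulr_le0; last exact: ltW.
by rewrite pmulr_lle0 ?invr_gt0 //; lra.
Qed.

(* The horocycle of [X] through [c] separates [p] from [q], hence meets the
   chord [pq] in the affine plane of the circle; from there one moves in this
   plane along the horocycle direction [e], either way, until the circle is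
   reached. *)
Lemma circle_equidistant c r p q X (t : R) : ideal X ->
  circle c r p -> circle c r q ->
  mink (lift p) (ilift X) < mink (lift c) (ilift X) ->
  mink (lift c) (ilift X) < mink (lift q) (ilift X) ->
  exists x, [/\ circle c r x,
    mink (lift x) (ilift X) = mink (lift c) (ilift X) &
    0 <= t * det3 (lift p) (lift q) (lift x)].
Proof.
move=> iX cp cq pX qX; have b0 := mink_lift_ideal c iX.
have qcp : mink (lift c) (lift p) = mink (lift c) (lift q).
  apply: oppr_inj; apply: arcosh_inj; rewrite ?mink_lift_ge1 //.
  by move: cp cq; rewrite /circle /dist /= => -> ->.
pose e := cross (lift c) (ilift X).
have ec : mink e (lift c) = 0 by rewrite mink_cross det3uvu.
have eX : mink e (ilift X) = 0 by rewrite mink_cross det3uvv.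
have ee : mink e e = mink (lift c) (ilift X) ^+ 2.
  by rewrite mink_cross_cross mink_ilift // mulr0 subr0.
have [a [b [a0 b0' ab zX]]] : exists a b, [/\ 0 <= a, 0 <= b, a + b = 1 &
    a * mink (lift p) (ilift X) + b * mink (lift q) (ilift X) =
    mink (lift c) (ilift X)].
  move: (mink (lift p) _) (mink (lift c) _) (mink (lift q) _) pX qX => s y w sy yw.
  exists ((w - y) / (w - s)), ((y - s) / (w - s)).
  by split; [rewrite divr_ge0 //; lra|rewrite divr_ge0 //; lra|field; lra|field; lra].
pose z := a *: lift p + b *: lift q.
have zc : mink z (lift c) = mink (lift c) (lift p).
  by rewrite !minkE !(minkC _ (lift c)) -qcp -mulrDl ab mul1r.
have zzE : mink z (ilift X) = mink (lift c) (ilift X) by rewrite !minkE.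
have zz : mink z z + 1 <= 0.
  rewrite !minkE !mink_lift (minkC (lift q)).
  have w := mink_lift_le p q.
  have : 0 <= a * b * (-1 - mink (lift p) (lift q)) by rewrite !mulr_ge0 //; lra.
  have : (a + b) ^+ 2 = 1 by rewrite ab expr1n.
  by lra.
have zpq : det3 (lift p) (lift q) z = 0.
  by rewrite det3Dr !det3Zr det3uvu det3uvv; ring.
clearbody z e.
have ee0 : 0 < mink e e by rewrite ee exprn_even_gt0 //= ltr0_neq0.
(* The equation puts [z + s *: e] on the sheet; the sign of [s] puts it on the side of [pq] selected
   by [t]. *)
have [s sE st] := quadratic_root (mink z e) (det3 (lift p) (lift q) e * t) ee0 zz.
have xE : lift (z + s *: e).1 = z + s *: e.
  apply: (@lift_of_future _ c).
    rewrite minkDl !minkDr !minkZl !minkZr (minkC e z); lra.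
  rewrite minkDl minkZl ec zc mulr0 addr0.
  by have := mink_lift_le c p; lra.
exists (z + s *: e).1; rewrite xE; split.
- rewrite -cp /circle /= /dist xE minkDr minkZr (minkC _ e) ec.
  by rewrite mulr0 addr0 minkC zc.
- by rewrite minkDl minkZl eX zzE mulr0 addr0.
- by rewrite det3Dr det3Zr zpq add0r mulrC -mulrA.
Qed.

Lemma arc_equidistant (A : set (R * R)) c r p q X : ideal X ->
  is_arc A c r p q ->
  mink (lift p) (ilift X) < mink (lift c) (ilift X) ->
  mink (lift c) (ilift X) < mink (lift q) (ilift X) ->
  exists2 x, A x & mink (lift x) (ilift X) = mink (lift c) (ilift X).
Proof.
move=> iX [_ cp cq [] ->] pX qX.
- have [x [cx xX]] := circle_equidistant 1 iX cp cq pX qX.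
  by rewrite mul1r => hx; exists x.
- have [x [cx xX]] := circle_equidistant (-1) iX cp cq pX qX.
  by rewrite mulN1r => hx; exists x => //; split=> //; rewrite /half_plane /= det3_swap.
Qed.

Lemma is_arcC (A : set (R * R)) c r p q : is_arc A c r p q -> is_arc A c r q p.
Proof.
by move=> [pq cp cq AE]; split=> //; [exact: nesym|case: AE; [right|left]].
Qed.

Lemma is_arc_left (A : set (R * R)) c r p q : is_arc A c r p q -> A p.
Proof.
move=> [_ cp _ [] ->]; split=> //; rewrite /half_plane /=.
  by rewrite det3uvu.
by rewrite det3uvv.
Qed.

Lemma is_arc_sub_circle (A : set (R * R)) c r p q :
  is_arc A c r p q -> A `<=` circle c r.
Proof. by move=> [_ _ _ [] ->] x []. Qed.

Lemma val_iter_ordS n k (i : 'I_n) : iter k (@ordS n) i = ((i + k) %% n)%N :> nat.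
Proof.
elim: k => [|k IH] /=; first by rewrite addn0 modn_small.
by rewrite IH -addn1 modnDml addn1 addnS.
Qed.

(** Twice [uphalf n] is [n.+1], which is 1 modulo [n]. *)
Lemma opposite_opposite n (i : 'I_n) : odd n -> opposite (opposite i) = ordS i.
Proof.
move=> on; rewrite /opposite -iterD addnn; apply/ord_inj.
rewrite val_iter_ordS /=.
have -> : (uphalf n).*2 = n.+1.
  by rewrite uphalf_half on doubleD -[in RHS](odd_double_half n) on.
by rewrite addnS -addSn modnDr.
Qed.

(** The total shift is a multiple of [n]: the chain of main diagonals closes up. *)
Lemma iter_opposite n (i : 'I_n) : iter n (@opposite n) i = i.
Proof.
have iterE k : iter k (@opposite n) i = iter (k * uphalf n)%N (@ordS n) i.
  by elim: k => //= k ->; rewrite /opposite -iterD mulSn.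
apply/ord_inj; rewrite iterE val_iter_ordS.
by rewrite addnC mulnC modnMDl modn_small.
Qed.

(* Otherwise, going along the odd cycle [i, opposite i, opposite (opposite i),
   ...], the Busemann function of [X] at the vertices would increase and
   decrease alternately. *)
Lemma reuleaux_equidistant n (v : 'I_n -> R * R) (A : 'I_n -> set (R * R)) r X :
  odd n -> ideal X ->
  (forall i, is_arc (A i) (v (opposite i)) r (v i) (v (ordS i))) ->
  exists i x, A i x /\
    mink (lift x) (ilift X) = mink (lift (v (opposite i))) (ilift X).
Proof.
move=> on iX arcA; apply: contrapT => no.
pose b i := mink (lift (v i)) (ilift X).
have neq i x : A i x -> mink (lift x) (ilift X) <> b (opposite i).
  by move=> Ax e; apply: no; exists i, x.
pose s i := b i < b (opposite i).
(* Both ends of side [i] lie strictly on the same side of the horocycle through the center of its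
   arc, and the second end is [opposite (opposite i)]. *)
have sN i : s (opposite i) = ~~ s i.
  rewrite /s opposite_opposite //.
  have /eqP := neq i _ (is_arc_left (arcA i)); rewrite -/(b i).
  have /eqP := neq i _ (is_arc_left (is_arcC (arcA i))); rewrite -/(b (ordS i)).
  case: (ltgtP (b (ordS i))) => // bi'; case: (ltgtP (b i)) => // bi _ _.
  - by have [x Ax /(neq _ _ Ax)] := arc_equidistant iX (is_arcC (arcA i)) bi' bi.
  - by have [x Ax /(neq _ _ Ax)] := arc_equidistant iX (arcA i) bi bi'.
pose i0 := Ordinal (odd_gt0 on).
have siter k : s (iter k (@opposite n) i0) = odd k (+) s i0.
  by elim: k => //= k IH; rewrite sN IH addNb.
by have := siter n; rewrite iter_opposite on; case: (s i0).
Qed.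

Lemma constant_width_reuleaux (K : set (R * R)) :
  reuleaux_polygon K -> constant_width K.
Proof.
move=> [[compK cK _] [d [n [v [A [[d0 dE on n3 _] [arcA bdK]]]]]]].
have clK : closed K by apply: compact_closed compK; exact: norm_hausdorff.
have AK i : A i `<=` K.
  move=> x Ax; have : (closure K `\` K°) x by rewrite bdK; exists i.
  by case=> /clK.
have Kd x y : K x -> K y -> dist x y <= d.
  move=> Kx Ky; rewrite -dE; apply: sup_upper_bound; last by exists (x, y).
  (* Without a genuine supremum [diameter K] would take the default value 0, contrary to [0 < d]. *)
  by apply: contrapT => /sup_out; rewrite -[sup _]/(diameter K) dE; lra.
exists d => // X iX.
have [i [x [Ax xX]]] := reuleaux_equidistant on iX arcA.
(* The diametral pair is the center of arc [i], itself an end of another arc and hence in [K], and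
   the point [x] of arc [i]. *)
apply: (width_eq_diametral cK d0 Kd iX (AK _ _ (is_arc_left (arcA (opposite i))))
  (AK _ _ Ax)); last by [].
exact: is_arc_sub_circle (arcA i) _ Ax.
Qed.

End Reuleaux.

Theorem mainTheorem4 (R : realType) :
  (forall (c : R * R) (r : R), 0 < r ->
     convex_body (disk c r) /\ constant_width (disk c r)) /\
  (forall K : set (R * R), reuleaux_polygon K ->
     convex_body K /\ constant_width K).
Proof.
split=> [c r r0|K rK].
  by split; [exact: convex_body_disk|exact: constant_width_disk].
by split; [case: rK|exact: constant_width_reuleaux].
Qed.
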